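(* Let $W$ be an irreducible and ergodic transition matrix on a finite set $\mathcal X$, let $g:\mathcal X\times\mathcal X\to\mathbb R$ be linearly independent under $W$, and let $\{W_\theta\}_{\theta\in\mathbb R}$ be the one-parameter exponential family of transition matrices generated by $W$ with the generator $g$, with potential function $\phi$ and expectation parameter $\eta(\theta)=\frac{d\phi}{d\theta}(\theta)$. Let $\{P_\theta\}_\theta$ be an arbitrary family of initial distributions on $\mathcal X$ smoothly parametrized by $\theta$, and suppose that $X^{n+1}=(X_{n+1},\dots,X_1)$ is distributed according to $W_\theta^{\times n}\times P_\theta$. Let $h$ be a real-valued function on $\mathcal X$ and let $\tilde g^n(X^{n+1}):=\sum_{i=1}^n g(X_{i+1},X_i)+h(X_1)$. Then for every $\theta$ $$\lim_{n\to\infty}\mathsf E_\theta\Bigl[\frac{\tilde g^n(X^{n+1})}{n}\Bigr]=\eta(\theta)$$ and $$\lim_{n\to\infty} n\,\mathsf E_\theta\Bigl[\Bigl(\frac{\tilde g^n(X^{n+1})}{n}-\eta(\theta)\Bigr)^2\Bigr]=\lim_{n\to\infty}\mathsf V_\theta\Bigl[\frac{\tilde g^n(X^{n+1})}{\sqrt n}\Bigr]=\frac{d^2\phi}{d\theta^2}(\theta).$$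
   Context: A transition matrix on a finite set $\mathcal X$ is a nonnegative matrix $W(x|x')$ with $\sum_x W(x|x')=1$ for every $x'$; $\mathcal X^2_W:=\{(x,x'):W(x|x')>0\}$. It acts on column vectors by $v\mapsto\sum_{x'}W(x|x')v(x')$. $W$ is irreducible if for all $x,x'$ there is $n$ with $W^n(x|x')>0$, and ergodic if it is irreducible and aperiodic. A single function $g$ is linearly independent under $W$ if there are no $f:\mathcal X\to\mathbb R$ and $c\in\mathbb R$ with $g(x,x')=f(x)-f(x')+c$ for all $(x,x')\in\mathcal X_W^2$. One-parameter exponential family: for $\theta\in\mathbb R$ let $\overline W_\theta(x|x'):=W(x|x')e^{\theta g(x,x')}$, let $\lambda_\theta$ be its Perron–Frobenius eigenvalue, $\phi(\theta):=\log\lambda_\theta$, and $\overline P^3_\theta$ the positive Perron–Frobenius eigenvector of $\overline W_\theta^T$. Put $W_\theta(x|x'):=\lambda_\theta^{-1}\overline P^3_\theta(x)\overline W_\theta(x|x')\overline P^3_\theta(x')^{-1}$. $W_\theta^{\times n}\times P_\theta(x_{n+1},\dots,x_1):=W_\theta(x_{n+1}|x_n)\cdots W_\theta(x_2|x_1)P_\theta(x_1)$; $\mathsf E_\theta$ and $\mathsf V_\theta$ denote expectation and variance under this distribution. *)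

(* Defs.v *)
From mathcomp Require Import all_boot all_order all_algebra.
From mathcomp Require Import all_classical all_reals all_analysis.
From mathcomp Require Import complex.
Set Implicit Arguments.
Unset Strict Implicit.
Unset Printing Implicit Defensive.
Import Order.TTheory GRing.Theory Num.Theory.
Import numFieldNormedType.Exports.
Local Open Scope classical_set_scope.
Local Open Scope ring_scope.

(* A kernel W(x|x') on a finite set X is encoded as W : X -> X -> R with      *)
(* W x x' = W(x|x'): the columns, not the rows, of a transition matrix sum    *)
(* to 1.                                                                      *)

Section Kernels.
Context {R : realType} {X : finType}.
Implicit Types (W A g : X -> X -> R) (v p : X -> R).

Definition distribution_on p : Prop :=
  (forall x, 0 <= p x) /\ \sum_x p x = 1.

Definition transition_matrix W : Prop := forall x', distribution_on (W ^~ x').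

Definition mx_of A : 'M[R]_#|X| := \matrix_(i, j) A (enum_val i) (enum_val j).

(* W^n(x|x') *)
Definition mpow A (n : nat) (x x' : X) : R :=
  (mx_of A ^+ n) (enum_rank x) (enum_rank x').

Definition irreducible W : Prop :=
  forall x x', exists2 n : nat, (0 < n)%N & 0 < mpow W n x x'.

(* The period gcd {n >= 1 | W^n(x|x) > 0} of every x is 1. *)
Definition aperiodic W : Prop :=
  forall x (d : nat),
    (forall n : nat, (0 < n)%N -> 0 < mpow W n x x -> (d %| n)%N) -> d = 1%N.

Definition ergodic W : Prop := irreducible W /\ aperiodic W.

Definition lin_indep W g : Prop :=
  ~ exists (f : X -> R) (c : R),
      forall x x', 0 < W x x' -> g x x' = f x - f x' + c.

(* The Perron-Frobenius eigenvalue of a nonnegative irreducible matrix is its *)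
(* spectral radius, taken over the complex eigenvalues. The library predicate *)
(* eigenvalue refers to row vectors, but the set of eigenvalues is the same   *)
(* as for column vectors.                                                     *)
Definition PF_eigenvalue A : R :=
  sup [set Normc.normc z
        | z in [set z : R[i] | eigenvalue (map_mx (real_complex R) (mx_of A)) z]].

(* v is a positive column eigenvector: A v = PF_eigenvalue A * v. It is       *)
(* unique only up to a positive factor.                                       *)
Definition PF_eigenvector A v : Prop :=
  (forall x, 0 < v x) /\
  (forall x, \sum_x' A x x' * v x' = PF_eigenvalue A * v x).

Definition tilted W g (theta : R) : X -> X -> R :=
  fun x x' => W x x' * expR (theta * g x x').

Definition potential W g (theta : R) : R := ln (PF_eigenvalue (tilted W g theta)).

(* W_theta, for P3 theta a positive Perron-Frobenius eigenvector of the       *)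
(* transpose of tilted W g theta; it does not depend on the normalization of  *)
(* P3 theta.                                                                  *)
Definition exp_family W g (P3 : R -> X -> R) (theta : R) : X -> X -> R :=
  fun x x' => (PF_eigenvalue (tilted W g theta))^-1 *
              P3 theta x * tilted W g theta x x' * (P3 theta x')^-1.

(* C^infinity in theta, in each of the finitely many coordinates *)
Definition smooth_family (P : R -> X -> R) : Prop :=
  forall (x : X) (k : nat) (theta : R),
    derivable ((fun t => P t x)^`(k)%classic) theta 1.

(* A path omega : {ffun 'I_n.+1 -> X} has omega i = x_(i+1), so that          *)
(* omega ord0 is the initial state x_1.                                       *)
Section Paths.
Variable n : nat.
Implicit Types (omega : {ffun 'I_n.+1 -> X}) (i : 'I_n).

Definition state_at omega i : X := omega (widen_ord (leqnSn n) i).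
Definition state_next omega i : X := omega (lift ord0 i).

(* the density of W^{x n} x p *)
Definition path_law W p omega : R :=
  (\prod_(i < n) W (state_next omega i) (state_at omega i)) * p (omega ord0).

Definition path_mean W p (F : {ffun 'I_n.+1 -> X} -> R) : R :=
  \sum_omega path_law W p omega * F omega.

Definition path_variance W p (F : {ffun 'I_n.+1 -> X} -> R) : R :=
  path_mean W p (fun omega => (F omega - path_mean W p F) ^+ 2).

Definition gtilde g (h : X -> R) omega : R :=
  \sum_(i < n) g (state_next omega i) (state_at omega i) + h (omega ord0).

End Paths.
End Kernels.

(* Main.v *)
Require Import Defs.
From mathcomp Require Import all_boot all_order all_algebra.
From mathcomp Require Import all_classical all_reals all_analysis.
From mathcomp Require Import complex ring lra.
Set Implicit Arguments.
Unset Strict Implicit.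
Unset Printing Implicit Defensive.
Import Order.TTheory GRing.Theory Num.Theory.
Import numFieldNormedType.Exports.
Local Open Scope classical_set_scope.
Local Open Scope ring_scope.

(** The normalized positive right eigenvector w of the tilted matrix A_t solves
    the bordered linear system (lam_t - A_t + J) w = 1, J being the all-ones
    matrix; the system is invertible, so w, and by transposition the left
    eigenvector p, are as smooth in t as the eigenvalue lam_t. Pairing A_t - A_s
    with p_s and w_t shows that lam is continuous, then that
    lam' = <p, A' w> / <p, w>; hence lam and p are twice differentiable.
    Differentiating p A = lam p once and twice yields, with f = p'/p and
    k = p''/p - f^2, that under W_theta the increments
    g(x,x') + f(x) - f(x') - eta have conditional mean 0 and conditional variance
    phi'' + k(x') - E[k(X_2) | X_1 = x']. So gtilde - n eta is, up to a bounded
    term, a martingale whose second moment is n phi'' + O(1). *)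

(** * Matrix inverses over algebras of functions *)

(** Abstracts what continuous, derivable and twice derivable functions have in common, so that one
    argument carries each kind of regularity from the eigenvalue to the eigenvectors. *)
Definition inverse_closed_algebra (R : realType) (S : (R -> R) -> Prop) : Prop :=
  [/\ forall c, S (fun=> c),
      forall f g, S f -> S g -> S (fun t => f t + g t),
      forall f g, S f -> S g -> S (fun t => f t * g t)
    & forall f, S f -> (forall t, f t != 0) -> S (fun t => (f t)^-1)].

Section InverseClosedAlgebra.
Variables (R : realType) (S : (R -> R) -> Prop).
Hypothesis algS : inverse_closed_algebra S.

Lemma algebra_sum (I : Type) (r : seq I) (P : pred I) (F : I -> R -> R) :
  (forall i, S (F i)) -> S (fun t => \sum_(i <- r | P i) F i t).
Proof.
case: algS => Sc SD _ _ SF; elim: r => [|i r IHr].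
  by under eq_fun do rewrite big_nil; exact: Sc.
under eq_fun do rewrite big_cons.
by case: (P i) => //; exact: SD.
Qed.

Lemma algebra_prod (I : Type) (r : seq I) (P : pred I) (F : I -> R -> R) :
  (forall i, S (F i)) -> S (fun t => \prod_(i <- r | P i) F i t).
Proof.
case: algS => Sc _ SM _ SF; elim: r => [|i r IHr].
  by under eq_fun do rewrite big_nil; exact: Sc.
under eq_fun do rewrite big_cons.
by case: (P i) => //; exact: SM.
Qed.

Lemma algebra_det (n : nat) (M : R -> 'M[R]_n) :
  (forall i j, S (fun t => M t i j)) -> S (fun t => \det (M t)).
Proof.
move=> SMij; have [Sc _ SM _] := algS; apply: algebra_sum => s; apply: (SM) => //.
exact: algebra_prod.
Qed.

(** Cramer's rule: an entry of the inverse is a signed minor times the reciprocal of the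
    determinant, and determinants are polynomial in the entries. *)
Lemma algebra_invmx (n : nat) (M : R -> 'M[R]_n) :
  (forall t, M t \in unitmx) ->
  (forall i j, S (fun t => M t i j)) ->
  forall i j, S (fun t => invmx (M t) i j).
Proof.
move=> Mu SMij i j; have [Sc _ SM SV] := algS.
have -> : (fun t => invmx (M t) i j) =
    (fun t => (\det (M t))^-1 * ((-1) ^+ (j + i) * \det (row' j (col' i (M t))))).
  by apply: funext => t; rewrite /invmx Mu !mxE.
apply: (SM).
  apply: SV; first exact: algebra_det.
  by move=> t; have := Mu t; rewrite unitmxE unitfE.
apply: (SM) => //; apply: algebra_det => a b.
by under eq_fun do rewrite !mxE.
Qed.

End InverseClosedAlgebra.

(** * Continuity and derivatives of functions of the parameter *)

Section Regularity.
Variable R : realType.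
Implicit Types f g : R -> R.

Definition everywhere_derivable f := forall t, derivable f t 1.

Definition twice_derivable f :=
  everywhere_derivable f /\ everywhere_derivable f^`()%classic.

Lemma difference_quotientE f (s : R) :
  (fun h => h^-1 *: ((f \o shift s) (h *: 1) - f s)) =
  (fun h => h^-1 *: (f (h + s) - f s)).
Proof. by apply: funext => h /=; rewrite [h%:A]mulr1. Qed.

Lemma continuous_algebra : inverse_closed_algebra (fun f => continuous f).
Proof.
split.
- by move=> c t; exact: cvg_cst.
- by move=> f g cf cg t; exact: cvgD (cf t) (cg t).
- by move=> f g cf cg t; exact: cvgM (cf t) (cg t).
- by move=> f cf f0 t; apply: cvgV (f0 t) (cf t).
Qed.

Lemma everywhere_derivable_algebra : inverse_closed_algebra everywhere_derivable.
Proof.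
split.
- by move=> c t; exact: derivable_cst.
- by move=> f g cf cg t; exact: derivableD (cf t) (cg t).
- by move=> f g cf cg t; exact: derivableM (cf t) (cg t).
- by move=> f cf f0 t; apply: derivableV (f0 t) (cf t).
Qed.

Lemma everywhere_derivable_continuous f :
  everywhere_derivable f -> continuous f.
Proof. by move=> df t; apply/differentiable_continuous/derivable1_diffP/df. Qed.

Lemma derive1_add f g : everywhere_derivable f -> everywhere_derivable g ->
  (fun t => f t + g t)^`()%classic = (fun t => f^`()%classic t + g^`()%classic t).
Proof.
by move=> df dg; apply: funext => t; rewrite !derive1E; exact: deriveD.
Qed.

Lemma derive1_mul f g : everywhere_derivable f -> everywhere_derivable g ->
  (fun t => f t * g t)^`()%classic = (fun t => f t * g^`()%classic t + g t * f^`()%classic t).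
Proof.
by move=> df dg; apply: funext => t; rewrite !derive1E; exact: deriveM.
Qed.

(** The right-hand side is written with products and inverses only, so that closure of a function
    algebra applies to it directly. *)
Lemma derive1_inv f : everywhere_derivable f -> (forall t, f t != 0) ->
  (fun t => (f t)^-1)^`()%classic = (fun t => - 1 * ((f t)^-1 * (f t)^-1 * f^`()%classic t)).
Proof.
move=> df f0; apply: funext => t; rewrite !derive1E deriveV //.
by rewrite mulN1r -invfM -expr2 scaleNr.
Qed.

(** The rules for sums, products and inverses express the derivative through sums, products and
    inverses of derivable functions, hence it is derivable again. *)
Lemma twice_derivable_algebra : inverse_closed_algebra twice_derivable.
Proof.
have [dc dD dM dV] := everywhere_derivable_algebra.
split.
- move=> c; split; first exact: dc.
  suff -> : (fun=> c)^`()%classic = (fun=> 0 : R) by exact: dc.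
  by apply: funext => t; rewrite derive1_cst.
- move=> f g [df df'] [dg dg']; split; first exact: dD.
  by rewrite derive1_add //; exact: dD.
- move=> f g [df df'] [dg dg']; split; first exact: dM.
  by rewrite derive1_mul //; apply: (dD); exact: dM.
- move=> f [df df'] f0; split; first exact: dV.
  rewrite derive1_inv //; apply: (dM); first exact: dc.
  by apply: (dM) => //; apply: (dM); exact: dV.
Qed.

Lemma is_derive_expR_scale (c t : R) :
  is_derive t 1 (fun s => expR (s * c)) (c * expR (t * c)).
Proof.
have dl : is_derive t 1 (fun s : R => s * c) c.
  have := is_deriveM (is_derive_id t (1 : R)) (is_derive_cst c t (1 : R)).
  by rewrite scaler0 add0r /cst /GRing.scale /= mulr1.
rewrite [c * _]mulrC.
exact: (@is_derive1_comp _ expR (fun s : R => s * c) t _ _ (is_derive_expR _) dl).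
Qed.

Lemma everywhere_derivable_expR_scale (c : R) :
  everywhere_derivable (fun t => expR (t * c)).
Proof. by move=> t; have [] := is_derive_expR_scale c t. Qed.

Lemma derive1_expR_scale (c : R) :
  (fun t => expR (t * c))^`()%classic = (fun t => c * expR (t * c)).
Proof.
by apply: funext => t; rewrite derive1E; have [] := is_derive_expR_scale c t.
Qed.

Lemma twice_derivable_expR_scale (c : R) : twice_derivable (fun t => expR (t * c)).
Proof.
have [dc _ dM _] := everywhere_derivable_algebra.
have d := @everywhere_derivable_expR_scale c.
by split=> //; rewrite derive1_expR_scale; apply: dM.
Qed.

Lemma derive1_sum (I : finType) (F : I -> R -> R) :
  (forall i, everywhere_derivable (F i)) ->
  (fun t => \sum_i F i t)^`()%classic = (fun t => \sum_i (F i)^`()%classic t).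
Proof.
move=> dF; elim: (index_enum I) => [|i r IHr].
  under eq_fun do rewrite big_nil; under [RHS]eq_fun do rewrite big_nil.
  by apply: funext => t; rewrite derive1_cst.
under eq_fun do rewrite big_cons; under [RHS]eq_fun do rewrite big_cons.
rewrite derive1_add //; first by rewrite IHr.
by apply: algebra_sum => //; exact: everywhere_derivable_algebra.
Qed.

End Regularity.

(** * Perron-Frobenius eigenvectors *)

(** Irreducibility without powers: a nonempty set of states closed under the edges of [A] is
    everything. It depends only on where [A] is positive, so it passes at once to tilted
    matrices. *)
Definition connected_support (R : realType) (X : finType) (A : X -> X -> R) :=
  forall Z : pred X,
    (forall x x', Z x -> 0 < A x x' -> Z x') -> forall x x', Z x -> Z x'.

Section PerronFrobenius.
Variables (R : realType) (X : finType).
Implicit Types (A W g : X -> X -> R) (x y : X).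

Lemma sum_enum_val (F : X -> R) : \sum_x F x = \sum_(i < #|X|) F (enum_val i).
Proof. exact/reindex/onW_bij/enum_val_bij. Qed.

Lemma sum_gt0 (F : X -> R) (x0 : X) : (forall x, 0 < F x) -> 0 < \sum_x F x.
Proof.
move=> F_gt0; rewrite (bigD1 x0) //= ltr_pwDl //.
by apply: sumr_ge0 => x _; exact: ltW.
Qed.

(** A positive entry of [W^(n+1)] from [x] to [x'] has a positive term through some [z] with
    [W x z > 0]; then [z] is in [Z], and induction on [n] leads on to [x']. *)
Lemma irreducible_connected W :
  (forall x x', 0 <= W x x') -> irreducible W -> connected_support W.
Proof.
move=> W0 irrW Z ZW x x' Zx; have [n _] := irrW x x'.
have mpow0 k a b : 0 <= (mx_of W ^+ k) a b.
  elim: k a b => [|k IHk] a b; first by rewrite expr0 mxE ler0n.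
  by rewrite exprS mxE; apply: sumr_ge0 => i _; rewrite mulr_ge0 ?mxE.
rewrite /mpow; elim: n x Zx => [|n IHn] x Zx.
  rewrite expr0 mxE; case: eqP => [/enum_rank_inj <- //|_]; last by rewrite ltxx.
rewrite exprS mxE => /gt_eqF sum_neq0.
have [z Zz zpos] : exists2 z, Z z & 0 < (mx_of W ^+ n) (enum_rank z) (enum_rank x').
  apply: contrapT => none; move/negP: sum_neq0; apply; apply/eqP.
  apply: big1 => i _; rewrite mxE enum_rankK.
  have [-> | Wxi] := eqVneq (W x (enum_val i)) 0; first by rewrite mul0r.
  have [-> | mi] := eqVneq ((mx_of W ^+ n) i (enum_rank x')) 0.
    by rewrite mulr0.
  case: none; exists (enum_val i); last by rewrite enum_valK lt_def mi mpow0.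
  by apply: ZW Zx _; rewrite lt_def Wxi W0.
exact: IHn zpos.
Qed.

(** The complement of a set closed under reversed edges is closed under the edges of [A]. *)
Lemma connected_support_transpose A :
  connected_support A -> connected_support (fun x x' => A x' x).
Proof.
move=> connA Z ZA x x' Zx; apply: contraT => nZx'.
have /= := connA (fun y => ~~ Z y) _ x' x nZx'; rewrite Zx; apply.
by move=> y y' nZy Ayy'; apply: contra nZy => Zy'; exact: ZA Ayy'.
Qed.

(** * Right eigenvectors in the presence of a positive left eigenvector *)

Section PositiveLeftEigenvector.
Variables (A : X -> X -> R) (lam : R) (p : X -> R).
Hypothesis A_ge0 : forall x x', 0 <= A x x'.
Hypothesis A_conn : connected_support A.
Hypothesis p_gt0 : forall x, 0 < p x.
Hypothesis p_eigen : forall x', \sum_x p x * A x x' = lam * p x'.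

Lemma left_eigenvalue_ge0 (x0 : X) : 0 <= lam.
Proof.
rewrite -(pmulr_lge0 _ (p_gt0 x0)) -p_eigen.
by apply: sumr_ge0 => x _; rewrite mulr_ge0 // ltW.
Qed.

Lemma pairing_left_eigenvector (y : X -> R) :
  \sum_x p x * (\sum_x' A x x' * y x') = lam * \sum_x p x * y x.
Proof.
under eq_bigr do rewrite mulr_sumr; rewrite exchange_big /= mulr_sumr.
apply: eq_bigr => x' _; rewrite mulrA -p_eigen mulr_suml.
by apply: eq_bigr => x _; rewrite mulrA.
Qed.

(* lam |y| <= A |y| holds pointwise, and pairing with p leaves no room for a
   strict inequality. *)
Lemma norm_eigenvector (y : X -> R) :
  (forall x, \sum_x' A x x' * y x' = lam * y x) ->
  forall x, \sum_x' A x x' * `|y x'| = lam * `|y x|.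
Proof.
move=> y_eigen x; have lam_ge0 := left_eigenvalue_ge0 x.
pose d z := p z * (\sum_x' A z x' * `|y x'| - lam * `|y z|).
have d_ge0 z : 0 <= d z.
  apply: mulr_ge0; first exact: ltW.
  rewrite subr_ge0 -{1}(ger0_norm lam_ge0) -normrM -y_eigen.
  apply: le_trans (ler_norm_sum _ _ _) _; apply: ler_sum => x' _.
  by rewrite normrM ger0_norm.
have : \sum_z d z = 0.
  rewrite /d; under eq_bigr do rewrite mulrBr mulrCA.
  by rewrite big_split /= pairing_left_eigenvector mulr_sumr sumrN subrr.
move/eqP; rewrite psumr_eq0 // => /allP/(_ x); rewrite mem_index_enum.
by move/(_ isT); rewrite mulf_eq0 gt_eqF //= subr_eq0 => /eqP.
Qed.

(** The zero set of [y] is closed under the edges of [A]: where [y z = 0], a sum of nonnegative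
    terms vanishes, so every [A z z' * y z'] does. If it were nonempty, it would contain [x0]. *)
Lemma nonneg_eigenvector_gt0 (y : X -> R) (x0 : X) :
  (forall x, 0 <= y x) ->
  (forall x, \sum_x' A x x' * y x' = lam * y x) ->
  y x0 != 0 -> forall x, 0 < y x.
Proof.
move=> y_ge0 y_eigen yx0 x; rewrite lt_def y_ge0 andbT.
apply: contra yx0 => yx; apply: (A_conn (Z := fun z => y z == 0)) yx.
move=> z z' /eqP yz Azz'; move: (y_eigen z); rewrite yz mulr0 => /eqP.
rewrite psumr_eq0 => [|i _]; last by rewrite mulr_ge0.
move=> /allP/(_ z'); rewrite mem_index_enum => /(_ isT).
by rewrite mulf_eq0 gt_eqF.
Qed.

(** This gives the simplicity of the eigenvalue: the eigenspace meets the hyperplane of total mass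
    zero only at 0. *)
Lemma zero_sum_eigenvector_eq0 (y : X -> R) :
  (forall x, \sum_x' A x x' * y x' = lam * y x) ->
  \sum_x y x = 0 -> forall x, y x = 0.
Proof.
(* a nonzero positive part of an eigenvector would be positive everywhere *)
have pos_part_eq0 (z : X -> R) : (forall x, \sum_x' A x x' * z x' = lam * z x) ->
    \sum_x z x = 0 -> forall x, `|z x| + z x = 0.
  move=> z_eigen z_sum x; apply: contrapT => /eqP zx.
  have zp := @nonneg_eigenvector_gt0 (fun x => `|z x| + z x) x.
  have {}zp : forall x, 0 < z x.
    move=> t; have := zp _ _ zx t.
    have -> : (0 < z t) = (0 < `|z t| + z t).
      by case: (ltrP 0 (z t)) => zt;
        [rewrite gtr0_norm // addr_gt0 | rewrite ler0_norm // addNr ltxx].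
    apply=> t'.
      by have := ler_norm (- z t'); rewrite normrN; lra.
    under eq_bigr do rewrite mulrDr.
    by rewrite big_split /= norm_eigenvector // z_eigen mulrDr.
  have : 0 < \sum_x z x by exact: sum_gt0 x zp.
  by rewrite z_sum ltxx.
move=> y_eigen y_sum x.
(* Used for both [y] and [- y], the claim gives [|y| + y = |y| - y = 0]. *)
have Ny_eigen t : \sum_x' A t x' * (- y x') = lam * (- y t).
  by under eq_bigr do rewrite mulrN; rewrite sumrN y_eigen mulrN.
have Ny_sum : \sum_t - y t = 0 by rewrite sumrN y_sum oppr0.
have := pos_part_eq0 _ y_eigen y_sum x.
have := pos_part_eq0 _ Ny_eigen Ny_sum x.
by rewrite normrN; lra.
Qed.

(* The rank-one summand makes lam - A invertible: it maps a right eigenvector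
   of total mass 1 to the all-ones vector. *)
Definition bordered_mx (B : X -> X -> R) (l : R) : 'M[R]_#|X| :=
  \matrix_(i, j) (l *+ (i == j) - B (enum_val i) (enum_val j) + 1).

Lemma bordered_mx_apply (B : X -> X -> R) (l : R) (y : X -> R) i :
  \sum_j bordered_mx B l i j * y (enum_val j) =
  l * y (enum_val i) - \sum_x' B (enum_val i) x' * y x' + \sum_x y x.
Proof.
rewrite !sum_enum_val.
have -> : l * y (enum_val i) = \sum_(j < #|X|) l *+ (i == j) * y (enum_val j).
  rewrite (bigD1 i) //= eqxx big1 ?addr0 // => j /negPf.
  by rewrite eq_sym => ->; rewrite mul0r.
rewrite -sumrB -big_split /=; apply: eq_bigr => j _.
by rewrite mxE; ring.
Qed.

(** For a kernel vector [y], pairing with [p] cancels [lam - A] and leaves the product of the total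
    masses of [p] and [y]. Hence [y] has total mass zero, so it is an eigenvector for [lam] and
    vanishes. *)
Lemma bordered_mx_unit (x0 : X) : bordered_mx A lam \in unitmx.
Proof.
(* [det0P] produces row vectors, so a column kernel vector is obtained from the transpose. *)
rewrite -unitmx_tr unitmxE unitfE; apply/det0P => -[v v0 vM].
pose y x := v 0 (enum_rank x).
have yM x : lam * y x - \sum_x' A x x' * y x' + \sum_z y z = 0.
  have := bordered_mx_apply A lam y (enum_rank x); rewrite enum_rankK => <-.
  have := congr1 (fun u : 'rV[R]_#|X| => u 0 (enum_rank x)) vM; rewrite mxE [RHS]mxE.
  by apply: etrans; apply: eq_bigr => j _; rewrite /y enum_valK [_^T _ _]mxE mulrC.
have y_sum : \sum_x y x = 0.
  have : \sum_x p x * (lam * y x - \sum_x' A x x' * y x' + \sum_z y z) = 0.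
    by apply: big1 => x _; rewrite yM mulr0.
  under eq_bigr do rewrite mulrDr mulrBr mulrCA.
  rewrite big_split sumrB /= pairing_left_eigenvector -mulr_sumr subrr add0r.
  rewrite -mulr_suml => /eqP; rewrite mulf_eq0 gt_eqF /=; first by move/eqP.
  exact: sum_gt0 x0 _.
have y_eigen x : \sum_x' A x x' * y x' = lam * y x.
  by have := yM x; rewrite y_sum addr0 => /subr0_eq ->.
have y0 := zero_sum_eigenvector_eq0 y_eigen y_sum.
move/eqP: v0; apply; apply/rowP => j.
by have := y0 (enum_val j); rewrite /y enum_valK mxE.
Qed.

(** On an eigenvector of total mass 1 the bordered matrix takes the constant value 1. The resulting
    closed formula is what makes regularity in the parameter visible. *)
Lemma normalized_eigenvectorE (y : X -> R) (x0 x : X) :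
  (forall x, \sum_x' A x x' * y x' = lam * y x) -> \sum_x y x = 1 ->
  y x = \sum_j invmx (bordered_mx A lam) (enum_rank x) j.
Proof.
move=> y_eigen y_sum; pose u : 'cV[R]_#|X| := \col_j y (enum_val j).
have Mu : bordered_mx A lam *m u = const_mx 1.
  apply/colP => i; rewrite !mxE; under eq_bigr do rewrite [u _ _]mxE.
  by rewrite bordered_mx_apply y_eigen y_sum subrr add0r.
have /colP/(_ (enum_rank x)) : u = invmx (bordered_mx A lam) *m const_mx 1.
  by rewrite -Mu mulKmx // bordered_mx_unit.
rewrite !mxE enum_rankK => ->; apply: eq_bigr => j _.
by rewrite [const_mx _ _ _]mxE mulr1.
Qed.

(** The left eigenvector makes [lam - A] singular, so some right eigenvector exists, of unknown
    signs; its absolute value is again an eigenvector, positive by connectedness, and is then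
    normalized. *)
Lemma normalized_right_eigenvector (x0 : X) :
  exists w : X -> R, [/\ forall x, 0 < w x, \sum_x w x = 1
    & forall x, \sum_x' A x x' * w x' = lam * w x].
Proof.
have : \det (lam%:M - mx_of A) = 0.
  apply/eqP/det0P; exists (\row_j p (enum_val j)).
    apply/eqP => /rowP/(_ (enum_rank x0)); rewrite !mxE enum_rankK.
    by move/eqP; rewrite gt_eqF.
  apply/rowP => j; rewrite mulmxBr mul_mx_scalar !mxE -p_eigen sum_enum_val.
  by apply/eqP; rewrite subr_eq0; apply/eqP/eq_bigr => i _; rewrite !mxE.
rewrite -det_tr => /eqP/det0P[v v0].
rewrite linearB /= tr_scalar_mx mulmxBr mul_mx_scalar => /subr0_eq vA.
pose y x := v 0 (enum_rank x).
have y_eigen x : \sum_x' A x x' * y x' = lam * y x.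
  have /rowP/(_ (enum_rank x)) := vA; rewrite !mxE => ->.
  rewrite sum_enum_val; apply: eq_bigr => j _.
  by rewrite /y !mxE enum_valK enum_rankK mulrC.
have [i vi] : exists i, v 0 i != 0.
  by apply: contrapT => none; move/eqP: v0; apply; apply/rowP => i; rewrite mxE;
    apply: contrapT => /eqP vi; apply: none; exists i.
have yi : `|y (enum_val i)| != 0 by rewrite normr_eq0 /y enum_valK.
have y_gt0 := nonneg_eigenvector_gt0 (fun x => normr_ge0 (y x))
  (norm_eigenvector y_eigen) yi.
have s_gt0 : 0 < \sum_x `|y x| by exact: sum_gt0 x0 y_gt0.
exists (fun x => `|y x| / \sum_x `|y x|); split=> [x||x].
- by rewrite divr_gt0.
- by rewrite -mulr_suml divff // gt_eqF.
- under eq_bigr do rewrite mulrA.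
  by rewrite -mulr_suml norm_eigenvector // mulrA.
Qed.

End PositiveLeftEigenvector.

End PerronFrobenius.

Lemma eigenvalue_trmx (F : fieldType) (n : nat) (B : 'M[F]_n) z :
  eigenvalue B^T z = eigenvalue B z.
Proof.
rewrite !eigenvalue_root_char; congr (root _ z).
rewrite /char_poly -[RHS]det_tr; congr (\det _).
by rewrite /char_poly_mx linearB /= tr_scalar_mx map_trmx.
Qed.

(** A matrix and its transpose have the same complex eigenvalues. This turns an eigenvector of the
    transposed tilted matrix into a left eigenvector for the eigenvalue that defines the
    potential. *)
Lemma PF_eigenvalue_transpose (R : realType) (X : finType) (A : X -> X -> R) :
  PF_eigenvalue (fun x x' => A x' x) = PF_eigenvalue A.
Proof.
have tr : mx_of (fun x x' => A x' x) = (mx_of A)^T.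
  by apply/matrixP => i j; rewrite !mxE.
have E z : eigenvalue (map_mx (real_complex R) (mx_of (fun x x' => A x' x))) z =
    eigenvalue (map_mx (real_complex R) (mx_of A)) z.
  by rewrite tr -map_trmx; exact: eigenvalue_trmx.
have E' : [set z | eigenvalue (map_mx (real_complex R) (mx_of (fun x x' => A x' x))) z]
  = [set z | eigenvalue (map_mx (real_complex R) (mx_of A)) z].
  by apply/funext => z; rewrite /mkset E.
exact (congr1 (fun D => sup [set Normc.normc z | z in D]) E').
Qed.

(** * Smoothness of the eigenpair and the Poisson equation *)

Section ExponentialTilting.
Variables (R : realType) (X : finType).
Implicit Types (W g : X -> X -> R) (lam : R -> R) (p w : R -> X -> R).

Lemma tilted_ge0 W g t x x' : (forall x x', 0 <= W x x') -> 0 <= tilted W g t x x'.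
Proof. by move=> W0; rewrite mulr_ge0 ?expR_ge0. Qed.

Lemma tilted_connected W g t :
  connected_support W -> connected_support (tilted W g t).
Proof.
move=> connW Z ZA; apply: connW => x x' Zx Wxx'.
by apply: ZA Zx _; rewrite mulr_gt0 ?expR_gt0.
Qed.

Lemma tilted_in_algebra (S : (R -> R) -> Prop) W g x x' :
  inverse_closed_algebra S -> (forall c, S (fun t => expR (t * c))) ->
  S (fun t => tilted W g t x x').
Proof. by move=> [Sc _ SM _] Sexp; apply: (SM). Qed.

(** By the inverse formula, [w t x] is built from exponentials in [t] and [lam t] by algebra
    operations, hence is as regular as [lam]. *)
Lemma normalized_eigenvector_in_algebra (S : (R -> R) -> Prop) W g lam p w :
  inverse_closed_algebra S -> (forall c, S (fun t => expR (t * c))) -> S lam ->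
  (forall x x', 0 <= W x x') -> connected_support W ->
  (forall t x, 0 < p t x) ->
  (forall t x', \sum_x p t x * tilted W g t x x' = lam t * p t x') ->
  (forall t, \sum_x w t x = 1) ->
  (forall t x, \sum_x' tilted W g t x x' * w t x' = lam t * w t x) ->
  forall x, S (fun t => w t x).
Proof.
move=> algS Sexp Slam W0 connW p0 pE w1 wE x; have [Sc SD SM _] := algS.
have A0 t y y' : 0 <= tilted W g t y y' by exact: tilted_ge0.
have connA t := @tilted_connected W g t connW.
have -> : (fun t => w t x) = (fun t =>
    \sum_j invmx (bordered_mx (tilted W g t) (lam t)) (enum_rank x) j).
  by apply: funext => t; exact: (normalized_eigenvectorE (A0 t) (connA t) (p0 t) (pE t) x).
apply: algebra_sum => // j; apply: algebra_invmx => //.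
  by move=> t; exact: (bordered_mx_unit (A0 t) (connA t) (p0 t) (pE t) x).
move=> a b; under eq_fun do rewrite mxE.
apply: (SD) (Sc 1); apply: (SD).
  by case: (a == b) => //; exact: Sc.
under eq_fun do rewrite -mulN1r.
by apply: (SM) => //; exact: tilted_in_algebra.
Qed.

(** * Regularity of the eigenvalue and its two eigenvectors *)

Section Eigenpair.
Variables (W g : X -> X -> R) (lam : R -> R) (p w : R -> X -> R).
Hypothesis W_ge0 : forall x x', 0 <= W x x'.
Hypothesis W_conn : connected_support W.
Hypothesis p_gt0 : forall t x, 0 < p t x.
Hypothesis p_sum : forall t, \sum_x p t x = 1.
Hypothesis p_eigen : forall t x', \sum_x p t x * tilted W g t x x' = lam t * p t x'.
Hypothesis w_gt0 : forall t x, 0 < w t x.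
Hypothesis w_sum : forall t, \sum_x w t x = 1.
Hypothesis w_eigen : forall t x, \sum_x' tilted W g t x x' * w t x' = lam t * w t x.

Local Notation pairing s t := (\sum_x p s x * w t x).

Lemma pairing_gt0 s t : 0 < pairing s t.
Proof.
rewrite lt_def; apply/andP; split; last first.
  by apply: sumr_ge0 => x _; rewrite mulr_ge0 // ltW.
rewrite psumr_neq0 => [|x _]; last by rewrite mulr_ge0 // ltW.
apply: contrapT => none; have := w_sum t; rewrite big1 => [/esym/eqP|x _].
  by rewrite oner_eq0.
by case: none; apply/hasP; exists x; rewrite ?mem_index_enum //= mulr_gt0.
Qed.

(** Taking the left vector at [s] and the right vector at [t] lets each matrix act on its own
    eigenvector. The identity is exact and involves no derivative of an eigenvector. *)
Lemma eigenvalue_difference s t :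
  (lam t - lam s) * pairing s t =
  \sum_x \sum_x' p s x * (tilted W g t x x' - tilted W g s x x') * w t x'.
Proof.
have psum := pairing_left_eigenvector (p_eigen s) (w t).
rewrite mulrBl -psum mulr_sumr -sumrB; apply: eq_bigr => x _.
rewrite mulrCA -w_eigen -mulrBr -sumrB mulr_sumr.
by apply: eq_bigr => x' _; ring.
Qed.

Lemma tilted_derivable x x' : everywhere_derivable (fun t => tilted W g t x x').
Proof.
apply: tilted_in_algebra; first exact: everywhere_derivable_algebra.
exact: everywhere_derivable_expR_scale.
Qed.

Lemma derive1_tilted x x' :
  (fun t => tilted W g t x x')^`()%classic = (fun t => g x x' * tilted W g t x x').
Proof.
have dW : everywhere_derivable (fun=> W x x') by move=> t; exact: derivable_cst.
rewrite (derive1_mul dW (@everywhere_derivable_expR_scale R (g x x'))).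
by apply: funext => t; rewrite derive1_expR_scale derive1_cst mulr0 addr0 mulrCA.
Qed.

Lemma tilted_continuous x x' : continuous (fun t => tilted W g t x x').
Proof.
apply: (tilted_in_algebra _ _ _ _ (continuous_algebra R)) => c.
exact/everywhere_derivable_continuous/everywhere_derivable_expR_scale.
Qed.

Lemma right_eigenvector_in_algebra (S : (R -> R) -> Prop) :
  inverse_closed_algebra S -> (forall c, S (fun t => expR (t * c))) -> S lam ->
  forall x, S (fun t => w t x).
Proof. by move=> *; apply: normalized_eigenvector_in_algebra p_gt0 p_eigen w_sum w_eigen _. Qed.

(** Transposing [W] and [g] transposes the tilted matrix and exchanges the roles of [p] and [w]. *)
Lemma left_eigenvector_in_algebra (S : (R -> R) -> Prop) :
  inverse_closed_algebra S -> (forall c, S (fun t => expR (t * c))) -> S lam ->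
  forall x, S (fun t => p t x).
Proof.
move=> *; apply: (@normalized_eigenvector_in_algebra S (fun x x' => W x' x)
  (fun x x' => g x' x) lam w p) => //.
- exact: connected_support_transpose.
- by move=> t x'; rewrite -w_eigen; apply: eq_bigr => x _; rewrite mulrC.
- by move=> t x'; rewrite -p_eigen; apply: eq_bigr => x _; rewrite mulrC.
Qed.

(** In [eigenvalue_difference] the eigenvector entries are at most 1, and the pairing is bounded
    below uniformly in [t]; so [lam t - lam s] is controlled by the entrywise distance [d t] of the
    matrices. *)
Lemma eigenvalue_continuous : continuous lam.
Proof.
(* [C] depends on [s] alone and [C * p s x >= 1] for every [x], hence [C] times the pairing is at
   least the total mass of [w t], which is 1. *)
move=> s; pose C := \sum_x (p s x)^-1.
pose d t := \sum_x \sum_x' `|tilted W g t x x' - tilted W g s x x'|.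
have C_ge0 : 0 <= C by apply: sumr_ge0 => x _; rewrite invr_ge0 ltW.
have C_pairing t : 1 <= C * pairing s t.
  rewrite -(w_sum t) mulr_sumr; apply: ler_sum => x _.
  rewrite mulrA; apply: ler_peMl; first exact: ltW.
  rewrite -(mulVf (lt0r_neq0 (p_gt0 s x))).
  apply: ler_wpM2r; first exact: ltW.
  rewrite /C (bigD1 x) //= lerDl.
  by apply: sumr_ge0 => y _; rewrite invr_ge0 ltW.
have le1 (q : R -> X -> R) t x : (forall x, 0 < q t x) -> \sum_x q t x = 1 -> q t x <= 1.
  move=> q0 <-; rewrite (bigD1 x) //= lerDl.
  by apply: sumr_ge0 => y _; rewrite ltW.
have lam_bound t : `|lam t - lam s| <= C * d t.
  apply: (@le_trans _ _ (`|lam t - lam s| * (C * pairing s t))).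
    by rewrite ler_peMr.
  rewrite mulrCA ler_wpM2l // -(gtr0_norm (pairing_gt0 s t)) -normrM.
  rewrite eigenvalue_difference.
  apply: le_trans (ler_norm_sum _ _ _) _; apply: ler_sum => x _.
  apply: le_trans (ler_norm_sum _ _ _) _; apply: ler_sum => x' _.
  rewrite !normrM (gtr0_norm (p_gt0 s x)) (gtr0_norm (w_gt0 t x')).
  rewrite -[leRHS]mul1r -[leRHS]mulr1.
  apply: ler_pM; rewrite ?mulr_ge0 ?normr_ge0 ?(ltW (p_gt0 s x)) ?(ltW (w_gt0 t x')) //.
    by apply: ler_wpM2r; rewrite ?normr_ge0 ?le1.
  exact: le1.
have d0 : d t @[t --> s] --> 0.
  have -> : 0 = d s.
    by rewrite /d; apply/esym; do 2!(apply: big1 => ? _); rewrite subrr normr0.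
  have cd : continuous d.
    do 2!(apply: (algebra_sum (continuous_algebra R)) => ?).
    move=> t.
    by apply: cvg_norm; apply: cvgB; [exact: tilted_continuous | exact: cvg_cst].
  exact: cd.
have Cd0 : C * d t @[t --> s] --> C * 0 by apply: cvgM => //; exact: cvg_cst.
rewrite mulr0 in Cd0.
apply/subr_cvg0/norm_cvg0P.
apply: (@squeeze_cvgr _ _ _ _ (fun=> 0) (fun t => C * d t) _ _ 0).
- by near=> t; rewrite normr_ge0 lam_bound.
- exact: cvg_cst.
- exact: Cd0.
Unshelve. all: by end_near.
Qed.

(** Divide [eigenvalue_difference] by the increment and pass to the limit: the matrix quotients
    converge to [g * A], and [w] is continuous because [lam] is. *)
Lemma is_derive_eigenvalue (s : R) : is_derive s 1 lam
  ((\sum_x \sum_x' p s x * (g x x' * tilted W g s x x') * w s x') / pairing s s).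
Proof.
have cexp c : continuous (fun t : R => expR (t * c)).
  exact/everywhere_derivable_continuous/everywhere_derivable_expR_scale.
have w_cont x : continuous (fun t => w t x).
  apply: (right_eigenvector_in_algebra (continuous_algebra R)) => //.
  exact: eigenvalue_continuous.
have shift_cvg (f : R -> R) : continuous f -> f (h + s) @[h --> 0^'] --> f s.
  by move=> cf; exact: (iffRL (continuous_withinNshiftx f s) (cf s)).
have Aderiv x x' : h^-1 *: (tilted W g (h + s) x x' - tilted W g s x x') @[h --> 0^']
    --> g x x' * tilted W g s x x'.
  have <- := congr1 (fun F => F s) (derive1_tilted x x').
  by have := @tilted_derivable x x' s; rewrite /derivable difference_quotientE; exact.
have Dcvg : h^-1 *: (lam (h + s) - lam s) @[h --> 0^'] -->
    (\sum_x \sum_x' p s x * (g x x' * tilted W g s x x') * w s x') / pairing s s.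
  have -> : (fun h => h^-1 *: (lam (h + s) - lam s)) = (fun h =>
     (\sum_x \sum_x' p s x * (h^-1 *: (tilted W g (h + s) x x' - tilted W g s x x'))
        * w (h + s) x') / pairing s (h + s)).
    apply: funext => h; have := eigenvalue_difference s (h + s).
    move/(canRL (mulfK (lt0r_neq0 (pairing_gt0 s (h + s))))) => ->.
    rewrite /GRing.scale /= mulrA; congr (_ / _).
    rewrite mulr_sumr; apply: eq_bigr => x _; rewrite mulr_sumr.
    by apply: eq_bigr => x' _; rewrite !mulrA [h^-1 * _]mulrC.
  apply: cvgM; last first.
    apply: cvgV; first by rewrite gt_eqF // pairing_gt0.
    apply: cvg_big => [|x _]; first exact: add_continuous.
    by apply: cvgM; [exact: cvg_cst | exact: (shift_cvg (fun t => w t x))].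
  apply: cvg_big => [|x _]; first exact: add_continuous.
  apply: cvg_big => [|x' _]; first exact: add_continuous.
  apply: cvgM; last exact: (shift_cvg (fun t => w t x')).
  by apply: cvgM; [exact: cvg_cst | exact: Aderiv].
apply: DeriveDef; last by rewrite -derive1E; exact: cvg_lim.
by rewrite /derivable difference_quotientE; apply/cvg_ex; eexists; exact: Dcvg.
Qed.

(** Bootstrap: [lam] derivable makes [p] and [w] derivable, and the formula for its derivative is an
    algebra expression in these. *)
Lemma eigenvalue_twice_derivable : twice_derivable lam.
Proof.
have algD := everywhere_derivable_algebra R.
have [_ _ dM dV] := algD.
have dexp := @everywhere_derivable_expR_scale R.
have dlam : everywhere_derivable lam by move=> s; have [] := is_derive_eigenvalue s.
have dw := right_eigenvector_in_algebra algD dexp dlam.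
have dp := left_eigenvector_in_algebra algD dexp dlam.
split; first exact: dlam.
have -> : lam^`()%classic = (fun s =>
    (\sum_x \sum_x' p s x * (g x x' * tilted W g s x x') * w s x') / pairing s s).
  by apply: funext => s; rewrite derive1E; have [] := is_derive_eigenvalue s.
apply: (dM).
  apply: (algebra_sum algD) => x; apply: (algebra_sum algD) => x'.
  apply: (dM); last exact: dw.
  apply: (dM); first exact: dp.
  apply: (dM); first by move=> t; exact: derivable_cst.
  exact: (tilted_in_algebra W g x x' algD dexp).
apply: (dV) => [|t]; last by rewrite gt_eqF // pairing_gt0.
by apply: (algebra_sum algD) => x; apply: (dM); [exact: dp | exact: dw].
Qed.

Lemma left_eigenvector_twice_derivable x : twice_derivable (fun t => p t x).
Proof.
apply: left_eigenvector_in_algebra.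
- exact: twice_derivable_algebra.
- exact: twice_derivable_expR_scale.
- exact: eigenvalue_twice_derivable.
Qed.

Hypothesis lam_gt0 : forall t, 0 < lam t.

Let phi t := ln (lam t).

Lemma derive1_log_eigenvalue :
  phi^`()%classic = (fun t => lam^`()%classic t * (lam t)^-1).
Proof.
have [dlam _] := eigenvalue_twice_derivable.
apply: funext => t; rewrite mulrC derive1E derive1E.
apply: (@derive_val _ _ _ _ _ phi).
apply: (is_derive1_comp (f := @ln R) (g := lam)); first exact: is_derive1_ln.
exact: derivableP.
Qed.

Lemma log_eigenvalue_twice_derivable : twice_derivable phi.
Proof.
have [dlam ddlam] := eigenvalue_twice_derivable.
have [_ _ dM dV] := everywhere_derivable_algebra R.
split.
  move=> t; apply: (@ex_derive _ _ _ _ _ phi).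
  apply: (is_derive1_comp (f := @ln R) (g := lam)); first exact: is_derive1_ln.
  exact: derivableP.
rewrite derive1_log_eigenvalue; apply: (dM); first exact: ddlam.
by apply: (dV) => [|t]; [exact: dlam | rewrite gt_eqF].
Qed.

Lemma derive2_log_eigenvalue t : phi^`(2)%classic t =
  lam^`(2)%classic t / lam t - (phi^`()%classic t) ^+ 2.
Proof.
have [dlam ddlam] := eigenvalue_twice_derivable.
have lam0 s : lam s != 0 by rewrite gt_eqF.
have [_ _ _ dV] := everywhere_derivable_algebra R.
rewrite derive1nS derive1n1 derive1_log_eigenvalue (derive1_mul ddlam (dV _ dlam lam0)).
rewrite (derive1_inv dlam lam0) derive1nS derive1n1.
by field.
Qed.

Let p1 x : R -> R := (fun t => p t x)^`()%classic.
Let p2 x : R -> R := (p1 x)^`()%classic.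

Lemma eigenvector_first_order t x' :
  \sum_x (p t x * (g x x' * tilted W g t x x') + tilted W g t x x' * p1 x t) =
  lam t * p1 x' t + p t x' * lam^`()%classic t.
Proof.
have dlam := proj1 eigenvalue_twice_derivable.
have dp x := proj1 (left_eigenvector_twice_derivable x).
have dA x := @tilted_derivable x x'.
have dM := let: And4 _ _ dM _ := everywhere_derivable_algebra R in dM.
have E : (fun t => \sum_x p t x * tilted W g t x x') = (fun t => lam t * p t x').
  by apply: funext => s; exact: p_eigen.
have := congr1 (fun F => derive1 F t) E.
rewrite (derive1_mul dlam (dp x')) derive1_sum => [<-|x]; last first.
  by apply: (dM); [exact: dp | exact: dA].
by apply: eq_bigr => x _; rewrite (derive1_mul (dp x) (dA x)) derive1_tilted.
Qed.

(** The first-order identity holds for every [t], so it can be differentiated again. The terms are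
    kept in the shape that the product rule yields. *)
Lemma eigenvector_second_order t x' :
  \sum_x ((p t x * (g x x' * (g x x' * tilted W g t x x'))
          + g x x' * tilted W g t x x' * p1 x t)
        + (tilted W g t x x' * p2 x t + p1 x t * (g x x' * tilted W g t x x'))) =
  (lam t * p2 x' t + p1 x' t * lam^`()%classic t)
  + (p t x' * lam^`(2)%classic t + lam^`()%classic t * p1 x' t).
Proof.
have [dlam ddlam] := eigenvalue_twice_derivable.
have dp x := proj1 (left_eigenvector_twice_derivable x).
have ddp x : everywhere_derivable (p1 x) := proj2 (left_eigenvector_twice_derivable x).
have dA x := @tilted_derivable x x'.
have [dc dD dM _] := everywhere_derivable_algebra R.
have dgA x : everywhere_derivable (fun t => g x x' * tilted W g t x x').
  by apply: (dM); [exact: dc | exact: dA].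
have E : (fun t => \sum_x (p t x * (g x x' * tilted W g t x x') + tilted W g t x x' * p1 x t))
    = (fun t => lam t * p1 x' t + p t x' * lam^`()%classic t).
  by apply: funext => s; exact: eigenvector_first_order.
have d1 x : everywhere_derivable (fun t => p t x * (g x x' * tilted W g t x x')).
  by apply: (dM); [exact: dp | exact: dgA].
have d2 x : everywhere_derivable (fun t => tilted W g t x x' * p1 x t).
  by apply: (dM); [exact: dA | exact: ddp].
have := congr1 (fun F => derive1 F t) E.
rewrite derive1_sum; last by move=> x; apply: (dD); [exact: d1 | exact: d2].
have d3 : everywhere_derivable (fun t => lam t * p1 x' t).
  by apply: (dM); [exact: dlam | exact: ddp].
have d4 : everywhere_derivable (fun t => p t x' * lam^`()%classic t).
  by apply: (dM); [exact: dp | exact: ddlam].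
rewrite (derive1_add d3 d4) (derive1_mul dlam (ddp x')) (derive1_mul (dp x') ddlam).
move=> <-; apply: eq_bigr => x _.
rewrite (derive1_add (d1 x) (d2 x)) (derive1_mul (dp x) (dgA x)).
rewrite (derive1_mul (dA x) (ddp x)) derive1_tilted.
by rewrite derive1Ml ?derive1_tilted //; exact: dA.
Qed.

(** * Conditional moments of the corrected increments *)

Section PoissonEquation.
Variable theta : R.
Let Q x x' : R := (lam theta)^-1 * p theta x * tilted W g theta x x' * (p theta x')^-1.
(** [f] and [k] are the first and second derivatives of [ln (p t x)] in [t], taken at [theta]. *)
Let f x : R := p1 x theta / p theta x.
Let k x : R := p2 x theta / p theta x - f x ^+ 2.
Let eta : R := phi^`()%classic theta.

(** Turns a conditional expectation under [Q] into a sum against [p * A], the form in which the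
    differentiated eigenvector equations are stated. *)
Let sum_Q x' (c : X -> R) : \sum_x Q x x' * c x =
  (lam theta * p theta x')^-1 * \sum_x p theta x * tilted W g theta x x' * c x.
Proof.
have lam0 := lt0r_neq0 (lam_gt0 theta); have p0 := lt0r_neq0 (p_gt0 theta x').
rewrite mulr_sumr; apply: eq_bigr => x _; rewrite /Q; field.
by rewrite lam0 p0.
Qed.

Lemma exp_family_transition : transition_matrix Q.
Proof.
move=> x'; split=> [x|].
  by rewrite !mulr_ge0 ?invr_ge0 ?tilted_ge0 // ltW.
transitivity (\sum_x Q x x' * 1); first by apply: eq_bigr => x _; rewrite mulr1.
rewrite sum_Q; under eq_bigr do rewrite mulr1.
by rewrite p_eigen mulVf // mulf_neq0 // lt0r_neq0.
Qed.

Let sum_Q_cst x' c : \sum_x Q x x' * c = c.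
Proof.
have [_ /= Q1] := exp_family_transition x'.
by have := congr1 (fun s => s * c) Q1; rewrite mulr_suml mul1r.
Qed.

Let Q_first_moment x' : \sum_x Q x x' * (g x x' + f x) = f x' + eta.
Proof.
have lam0 := lt0r_neq0 (lam_gt0 theta); have p0 x := lt0r_neq0 (p_gt0 theta x).
rewrite sum_Q.
have -> : \sum_x p theta x * tilted W g theta x x' * (g x x' + f x) =
    lam theta * p1 x' theta + p theta x' * lam^`()%classic theta.
  rewrite -eigenvector_first_order; apply: eq_bigr => x _.
  by rewrite /f; field; exact: p0.
rewrite /eta derive1_log_eigenvalue /f; field.
by rewrite lam0 p0.
Qed.

(** The increment is the score, that is, the derivative in the parameter of the logarithm of the
    transition probability; its mean vanishes by the first-order identity. *)
Lemma exp_family_increment_mean x' :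
  \sum_x Q x x' * (g x x' + f x - f x' - eta) = 0.
Proof.
under eq_bigr do rewrite -addrA mulrDr.
by rewrite big_split /= Q_first_moment sum_Q_cst; ring.
Qed.

(** This is the Fisher information identity: the log transition probability has second derivative
    [k x - k x' - phi''], and the mean square of the score is minus its expectation. *)
Lemma exp_family_increment_variance x' :
  \sum_x Q x x' * (g x x' + f x - f x' - eta) ^+ 2 =
  phi^`(2)%classic theta + k x' - \sum_x Q x x' * k x.
Proof.
have lam0 := lt0r_neq0 (lam_gt0 theta); have p0 x := lt0r_neq0 (p_gt0 theta x).
(* Multiplied by [p * A], the averaged function is the second derivative of [p * A], so the
   second-order identity evaluates the sum. *)
have second : \sum_x Q x x' * (g x x' ^+ 2 + 2 * f x * g x x' + p2 x theta / p theta x) =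
    p2 x' theta / p theta x' + 2 * f x' * eta + lam^`(2)%classic theta / lam theta.
  rewrite sum_Q.
  have -> : \sum_x p theta x * tilted W g theta x x' *
        (g x x' ^+ 2 + 2 * f x * g x x' + p2 x theta / p theta x) =
      (lam theta * p2 x' theta + p1 x' theta * lam^`()%classic theta)
      + (p theta x' * lam^`(2)%classic theta + lam^`()%classic theta * p1 x' theta).
    rewrite -eigenvector_second_order; apply: eq_bigr => x _.
    by rewrite /f; field; exact: p0.
  rewrite /eta derive1_log_eigenvalue /f; field.
  by rewrite lam0 p0.
(* Expand the square around [f x' + eta]; since [k = p''/p - f^2], subtracting [k] restores the term
   [f^2]. *)
transitivity (\sum_x (Q x x' * (g x x' ^+ 2 + 2 * f x * g x x' + p2 x theta / p theta x)
   + Q x x' * (g x x' + f x) * (- 2 * (f x' + eta)) + Q x x' * (f x' + eta) ^+ 2 - Q x x' * k x)).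
  by apply: eq_bigr => x _; rewrite /k; ring.
have mixed : \sum_x Q x x' * (g x x' + f x) * (- 2 * (f x' + eta)) =
    (f x' + eta) * (- 2 * (f x' + eta)).
  by rewrite -mulr_suml; congr (_ * _); exact: Q_first_moment.
rewrite derive2_log_eigenvalue -/eta.
move: second; set L2 := lam^`(2)%classic theta => second.
rewrite sumrB !big_split /= second mixed sum_Q_cst.
by rewrite /k; ring.
Qed.

End PoissonEquation.

End Eigenpair.

End ExponentialTilting.

(** * Martingale decomposition along Markov paths *)

Section MarkovPaths.
Variables (R : realType) (X : finType) (Q : X -> X -> R) (q : X -> R).
Hypothesis Q_transition : transition_matrix Q.
Hypothesis q_distr : distribution_on q.
Local Notation path n := {ffun 'I_n.+1 -> X}.

(** Appends [x] as the last state: [unlift ord_max] returns [None] exactly at the last index. *)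
Definition extend_path n (omega : path n) (x : X) : path n.+1 :=
  [ffun i => if unlift ord_max i is Some j then omega j else x].

Lemma extend_path_max n (omega : path n) x : extend_path omega x ord_max = x.
Proof. by rewrite ffunE unlift_none. Qed.

Lemma extend_path_lift n (omega : path n) x j :
  extend_path omega x (lift ord_max j) = omega j.
Proof. by rewrite ffunE liftK. Qed.

Lemma extend_path_ord0 n (omega : path n) x : extend_path omega x ord0 = omega ord0.
Proof.
rewrite -(extend_path_lift omega x); congr (extend_path _ _ _).
by apply: val_inj; exact: esym (lift_max ord0).
Qed.

Lemma state_at_extend n (omega : path n) x (i : 'I_n) :
  state_at (extend_path omega x) (widen_ord (leqnSn n) i) = state_at omega i.
Proof.
rewrite /state_at -(extend_path_lift omega x); congr (extend_path _ _ _).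
by apply: val_inj; exact: esym (lift_max (widen_ord (leqnSn n) i)).
Qed.

Lemma state_next_extend n (omega : path n) x (i : 'I_n) :
  state_next (extend_path omega x) (widen_ord (leqnSn n) i) = state_next omega i.
Proof.
rewrite /state_next -(extend_path_lift omega x); congr (extend_path _ _ _).
by apply: val_inj; exact: esym (lift_max (lift ord0 i)).
Qed.

Lemma state_at_extend_max n (omega : path n) x :
  state_at (extend_path omega x) ord_max = omega ord_max.
Proof.
rewrite /state_at -(extend_path_lift omega x); congr (extend_path _ _ _).
by apply: val_inj; exact: esym (lift_max ord_max).
Qed.

Lemma state_next_extend_max n (omega : path n) x :
  state_next (extend_path omega x) ord_max = x.
Proof.
rewrite -[RHS](extend_path_max omega x) /state_next; congr (extend_path _ _ _).
exact: val_inj.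
Qed.

Lemma sum_transitions_extend n (c : X -> X -> R) (omega : path n) x :
  \sum_(i < n.+1) c (state_next (extend_path omega x) i) (state_at (extend_path omega x) i)
  = \sum_(i < n) c (state_next omega i) (state_at omega i) + c x (omega ord_max).
Proof.
rewrite big_ord_recr /= state_next_extend_max state_at_extend_max; congr (_ + _).
by apply: eq_bigr => i _; rewrite state_next_extend state_at_extend.
Qed.

Lemma path_law_extend n (omega : path n) x :
  path_law Q q (extend_path omega x) = path_law Q q omega * Q x (omega ord_max).
Proof.
rewrite /path_law big_ord_recr /= state_next_extend_max state_at_extend_max.
rewrite extend_path_ord0 mulrAC; congr (_ * _ * _).
by apply: eq_bigr => i _; rewrite state_next_extend state_at_extend.
Qed.

(** The tower property, conditioning on all states but the last; it drives the inductions on path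
    length below. *)
Lemma path_meanS n (F : path n.+1 -> R) :
  path_mean Q q F =
  path_mean Q q (fun omega : path n =>
    \sum_x Q x (omega ord_max) * F (extend_path omega x)).
Proof.
rewrite /path_mean; under [RHS]eq_bigr do rewrite mulr_sumr.
rewrite pair_bigA /= (reindex (fun u : path n * X => extend_path u.1 u.2)) /=.
  by apply: eq_bigr => u _; rewrite path_law_extend mulrA.
apply: onW_bij; exists (fun omega : path n.+1 =>
    ([ffun j => omega (lift ord_max j)], omega ord_max)) => [[omega x]|omega] /=.
  congr (_, _); last exact: extend_path_max.
  by apply/ffunP => j; rewrite ffunE extend_path_lift.
apply/ffunP => i; case: (unliftP ord_max i) => [j|] ->.
  by rewrite extend_path_lift ffunE.
by rewrite extend_path_max.
Qed.

Lemma path_meanD n (F G : path n -> R) :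
  path_mean Q q (fun omega => F omega + G omega) = path_mean Q q F + path_mean Q q G.
Proof. by rewrite /path_mean -big_split; apply: eq_bigr => omega _; rewrite mulrDr. Qed.

Lemma path_meanZ n c (F : path n -> R) :
  path_mean Q q (fun omega => c * F omega) = c * path_mean Q q F.
Proof. by rewrite /path_mean mulr_sumr; apply: eq_bigr => omega _; rewrite mulrCA. Qed.

Lemma path_mean_cst n c : path_mean Q q (fun _ : path n => c) = c.
Proof.
have -> : (fun _ : path n => c) = (fun _ => c * 1) by apply: funext => ?; rewrite mulr1.
rewrite path_meanZ -[RHS]mulr1; congr (_ * _).
elim: n => [|n IHn]; last first.
  rewrite path_meanS -[RHS]IHn; congr path_mean; apply: funext => omega.
  by under eq_bigr do rewrite mulr1; have [] := Q_transition (omega ord_max).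
transitivity (\sum_x q x); last by have [] := q_distr.
rewrite /path_mean (reindex (fun x => [ffun=> x] : path 0)) /=.
  by apply: eq_bigr => x _; rewrite /path_law big_ord0 mul1r mulr1 ffunE.
apply: onW_bij; exists (fun omega : path 0 => omega ord0) => [x|omega].
  by rewrite ffunE.
by apply/ffunP => i; rewrite ffunE (ord1 i).
Qed.

Lemma path_law_ge0 n (omega : path n) : 0 <= path_law Q q omega.
Proof.
have [q_ge0 _] := q_distr; rewrite mulr_ge0 // prodr_ge0 // => i _.
by have [] := Q_transition (state_at omega i).
Qed.

Lemma le_path_mean n (F G : path n -> R) :
  (forall omega, F omega <= G omega) -> path_mean Q q F <= path_mean Q q G.
Proof. by move=> FG; apply: ler_sum => omega _; rewrite ler_wpM2l ?path_law_ge0. Qed.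

Lemma path_mean_norm_le n (F : path n -> R) c :
  (forall omega, `|F omega| <= c) -> `|path_mean Q q F| <= c.
Proof.
move=> Fc; rewrite ler_norml -{2}(path_mean_cst n c) -(path_mean_cst n (- c)).
by apply/andP; split; apply: le_path_mean => omega; have := Fc omega;
  rewrite ler_norml => /andP[].
Qed.

Section MartingaleDecomposition.
Variables (g : X -> X -> R) (f k : X -> R) (eta v : R).
Let d x x' := g x x' + f x - f x' - eta.
Hypothesis d_mean : forall x', \sum_x Q x x' * d x x' = 0.
Hypothesis d_variance : forall x',
  \sum_x Q x x' * d x x' ^+ 2 = v + k x' - \sum_x Q x x' * k x.

Definition martingale_part n (omega : path n) : R :=
  \sum_(i < n) d (state_next omega i) (state_at omega i).

Lemma martingale_part_extend n (omega : path n) x :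
  martingale_part (extend_path omega x) = martingale_part omega + d x (omega ord_max).
Proof. exact: sum_transitions_extend. Qed.

Lemma martingale_mean n : path_mean Q q (@martingale_part n) = 0.
Proof.
elim: n => [|n IHn].
  have -> : @martingale_part 0 = fun=> 0.
    by apply: funext => omega; exact: big_ord0.
  exact: path_mean_cst.
rewrite path_meanS -[RHS]IHn; congr path_mean; apply: funext => omega.
under eq_bigr do rewrite martingale_part_extend mulrDr.
rewrite big_split /= d_mean addr0 -mulr_suml.
by have [_ ->] := Q_transition (omega ord_max); rewrite mul1r.
Qed.

(** Adding [k] at the last state compensates the state-dependent part of the conditional variance:
    each step adds exactly [v], the cross term having conditional mean zero. *)
Lemma martingale_second_moment n :
  path_mean Q q (fun omega : path n => martingale_part omega ^+ 2 + k (omega ord_max)) =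
  n%:R * v + path_mean Q q (fun omega : path 0 => k (omega ord_max)).
Proof.
elim: n => [|n IHn].
  rewrite mul0r add0r; congr path_mean; apply: funext => omega.
  by rewrite /martingale_part big_ord0 expr0n add0r.
rewrite path_meanS -[in RHS]addn1 natrD mulrDl mul1r addrAC -IHn.
rewrite -[X in _ = _ + X](path_mean_cst n v) -path_meanD; congr path_mean.
apply: funext => omega; set l := omega ord_max; set S := martingale_part omega.
have -> : \sum_x Q x l * (martingale_part (extend_path omega x) ^+ 2
      + k (extend_path omega x ord_max)) =
    \sum_x (Q x l * S ^+ 2 + Q x l * d x l * (2 * S) + Q x l * d x l ^+ 2 + Q x l * k x).
  apply: eq_bigr => x _.
  by rewrite extend_path_max martingale_part_extend -/l -/S; ring.
rewrite !big_split /= -!mulr_suml d_mean d_variance.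
by have [_ ->] := Q_transition l; ring.
Qed.

Lemma gtilde_decomposition h n (omega : path n) :
  gtilde g h omega - n%:R * eta =
  martingale_part omega + (h (omega ord0) + f (omega ord0) - f (omega ord_max)).
Proof.
have tele : \sum_(i < n) (f (state_next omega i) - f (state_at omega i)) =
    f (omega ord_max) - f (omega ord0).
  (* [inord] reads the path at natural-number indices, so that the sum telescopes. *)
  pose u i := f (omega (inord i)).
  transitivity (\sum_(0 <= i < n) (u i.+1 - u i)).
    rewrite big_mkord; apply: eq_bigr => i _; rewrite /u /state_next /state_at.
    have i_lt := ltn_ord i; congr (f (omega _) - f (omega _));
      by apply: val_inj; rewrite /= inordK // ltnW.
  rewrite telescope_sumr // /u.
  by congr (f (omega _) - f (omega _)); apply: val_inj; rewrite /= inordK.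
have -> : martingale_part omega =
    \sum_(i < n) g (state_next omega i) (state_at omega i)
    + \sum_(i < n) (f (state_next omega i) - f (state_at omega i)) - n%:R * eta.
  have -> : n%:R * eta = \sum_(i < n) eta by rewrite sumr_const card_ord mulr_natl.
  by rewrite -big_split -sumrB; apply: eq_bigr => i _; rewrite /d /=; ring.
by rewrite tele /gtilde; ring.
Qed.

Lemma norm_le_sum_norm (c : X -> R) x : `|c x| <= \sum_y `|c y|.
Proof. by rewrite (bigD1 x) //= lerDl; apply: sumr_ge0. Qed.

(** The martingale part has mean zero, and the remaining boundary term is bounded uniformly in
    [n]. *)
Lemma gtilde_mean_bounded h : exists B : R, forall n,
  `|path_mean Q q (fun omega : path n => gtilde g h omega - n%:R * eta)| <= B.
Proof.
exists (\sum_x `|h x| + \sum_x `|f x| + \sum_x `|f x|) => n.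
under eq_fun do rewrite gtilde_decomposition.
rewrite path_meanD martingale_mean add0r; apply: path_mean_norm_le => omega.
apply: le_trans (ler_normB _ _) _; rewrite lerD ?norm_le_sum_norm //.
by apply: le_trans (ler_normD _ _) _; rewrite lerD ?norm_le_sum_norm.
Qed.

(** With [S] the martingale part and [b] the boundary term, [S^2] contributes [n v + O(1)]. The
    cross term is split with weight [r = sqrt n], which balances the growth of [S^2] against the
    bounded [b^2] and costs only [O(r)]. *)
Lemma gtilde_second_moment_bounded h : exists C : R, forall n : nat, (0 < n)%N ->
  `|path_mean Q q (fun omega : path n => (gtilde g h omega - n%:R * eta) ^+ 2) - n%:R * v|
  <= C * Num.sqrt n%:R.
Proof.
pose B := \sum_x `|h x| + \sum_x `|f x| + \sum_x `|f x|.
pose K := \sum_x `|k x|.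
(* Errors as multiples of [r >= 1]: [2 K] from the second moment of [S], [|v| + 2 K] from its
   quotient by [r], and [2 B^2] from the terms in [b]. *)
exists (4 * K + `|v| + 2 * B ^+ 2) => n n_gt0.
pose b (omega : path n) := h (omega ord0) + f (omega ord0) - f (omega ord_max).
pose S := @martingale_part n.
have b_le omega : `|b omega| <= B.
  apply: le_trans (ler_normB _ _) _; rewrite lerD ?norm_le_sum_norm //.
  by apply: le_trans (ler_normD _ _) _; rewrite lerD ?norm_le_sum_norm.
pose V := path_mean Q q (fun omega => S omega ^+ 2).
have V_le : `|V - n%:R * v| <= 2 * K.
  have := martingale_second_moment n; rewrite path_meanD -/S -/V => VE.
  have -> : V - n%:R * v = path_mean Q q (fun omega : path 0 => k (omega ord_max))
      - path_mean Q q (fun omega : path n => k (omega ord_max)) by lra.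
  apply: le_trans (ler_normB _ _) _; rewrite mulr2n mulrDl mul1r.
  by rewrite lerD // path_mean_norm_le // => omega; exact: norm_le_sum_norm.
have b2_le omega : b omega ^+ 2 <= B ^+ 2.
  by rewrite -real_normK ?num_real // lerXn2r ?nnegrE // (le_trans _ (b_le omega)).
set r := Num.sqrt n%:R.
have r_ge1 : 1 <= r by rewrite -[1]sqrtr1 ler_sqrt ?ler1n.
have r2 : n%:R = r ^+ 2 by rewrite sqr_sqrtr.
have r_gt0 : 0 < r by exact: lt_le_trans r_ge1.
(* AM-GM: [2 |S b| <= S^2 / r + r b^2] *)
pose G omega := r^-1 * S omega ^+ 2 + (r * B ^+ 2 + B ^+ 2).
have G_le omega : `|2 * (S omega * b omega) + b omega ^+ 2| <= G omega.
  (* The sign [s] is 1 or -1, covering both sides of the absolute value. *)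
  have amgm s : s ^+ 2 = 1 -> s * (2 * (S omega * b omega)) <= r^-1 * S omega ^+ 2 + r * b omega ^+ 2.
    move=> s2; rewrite -subr_ge0.
    have -> : r^-1 * S omega ^+ 2 + r * b omega ^+ 2 - s * (2 * (S omega * b omega)) =
        r^-1 * (S omega - s * r * b omega) ^+ 2.
      have -> : (S omega - s * r * b omega) ^+ 2 =
          S omega ^+ 2 - 2 * s * r * (S omega * b omega) + s ^+ 2 * (r * b omega) ^+ 2 by ring.
      by rewrite s2; field; rewrite gt_eqF.
    by rewrite mulr_ge0 ?sqr_ge0 // invr_ge0 ltW.
  have rb : r * b omega ^+ 2 <= r * B ^+ 2 by rewrite ler_wpM2l // ltW.
  have := amgm 1 (expr1n _ _); have := amgm (- 1) (sqrr_sign _ 1).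
  have := b2_le omega; have := sqr_ge0 (b omega).
  rewrite /G ler_norml; lra.
have meanE : path_mean Q q (fun omega : path n => (gtilde g h omega - n%:R * eta) ^+ 2)
    = V + path_mean Q q (fun omega => 2 * (S omega * b omega) + b omega ^+ 2).
  rewrite -path_meanD; congr path_mean; apply: funext => omega.
  by rewrite gtilde_decomposition -/(b omega) -/S; ring.
have rest_le : `|path_mean Q q (fun omega => 2 * (S omega * b omega) + b omega ^+ 2)|
    <= r^-1 * V + (r * B ^+ 2 + B ^+ 2).
  rewrite -(path_mean_cst n (r * B ^+ 2 + B ^+ 2)) -path_meanZ -path_meanD.
  apply: le_trans (ler_norm_sum _ _ _) _; apply: ler_sum => omega _.
  by rewrite normrM ger0_norm ?path_law_ge0 // ler_wpM2l ?path_law_ge0 ?G_le.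
have K_ge0 : 0 <= K by apply: sumr_ge0.
have rV_le : r^-1 * V <= r * `|v| + 2 * K * r.
  rewrite -[leRHS](mulKf (lt0r_neq0 r_gt0)) ler_wpM2l ?invr_ge0 ?(ltW r_gt0) //.
  have : V <= n%:R * `|v| + 2 * K.
    have : n%:R * v <= n%:R * `|v| by rewrite ler_wpM2l // ler_norm.
    by have := ler_norm (V - n%:R * v); lra.
  move/le_trans; apply; rewrite r2.
  have : 2 * K <= 2 * K * r ^+ 2 by rewrite ler_peMr ?mulr_ge0 // exprn_ege1.
  lra.
have B2 : B ^+ 2 <= r * B ^+ 2 by rewrite ler_peMl // sqr_ge0.
have K2 : 2 * K <= 2 * K * r by rewrite ler_peMr // mulr_ge0.
rewrite meanE addrAC; apply: le_trans (ler_normD _ _) _.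
have -> : (4 * K + `|v| + 2 * B ^+ 2) * r =
    2 * K * r + 2 * K * r + r * `|v| + r * B ^+ 2 + r * B ^+ 2 by ring.
by move: V_le rest_le rV_le B2 K2; lra.
Qed.

End MartingaleDecomposition.
End MarkovPaths.

(** * Passage to the limit from bounds of order [1 / sqrt n] *)

Lemma cvg_inv_sqrt_bound (R : realType) (u : nat -> R) (l C : R) :
  (forall n, (0 < n)%N -> `|u n - l| <= C / Num.sqrt n%:R) -> u @ \oo --> l.
Proof.
(* The shift avoids [n = 0], and [harmonic n] is [1 / (n + 1)]. *)
move=> u_le; rewrite -cvg_shiftS /=; apply/subr_cvg0/norm_cvg0P.
have s0 : Num.sqrt (harmonic n) @[n --> \oo] --> (0 : R).
  rewrite -[X in _ --> X]sqrtr0; apply: continuous_cvg; last exact: cvg_harmonic.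
  exact: sqrt_continuous.
have Cs0 : C * Num.sqrt (harmonic n) @[n --> \oo] --> C * 0.
  by apply: cvgM => //; exact: cvg_cst.
rewrite mulr0 in Cs0.
apply: (@squeeze_cvgr _ _ _ _ (fun=> 0) (fun n => C * Num.sqrt (harmonic n)) _ _ 0).
- by near=> n; rewrite normr_ge0 /harmonic sqrtrV ?ler0n //= u_le.
- exact: cvg_cst.
- exact: Cs0.
Unshelve. all: by end_near.
Qed.

Section Limits.
Variables (R : realType) (X : finType) (Q : X -> X -> R) (q : X -> R).
Hypothesis Q_transition : transition_matrix Q.
Hypothesis q_distr : distribution_on q.
Variables (g : X -> X -> R) (h f k : X -> R) (eta v : R).
Hypothesis d_mean : forall x', \sum_x Q x x' * (g x x' + f x - f x' - eta) = 0.
Hypothesis d_variance : forall x',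
  \sum_x Q x x' * (g x x' + f x - f x' - eta) ^+ 2 = v + k x' - \sum_x Q x x' * k x.
Local Notation path n := {ffun 'I_n.+1 -> X}.
Local Notation E n F := (path_mean Q q (fun omega : path n => F omega)).
Let Y n (omega : path n) := gtilde g h omega - n%:R * eta.

Let le_inv_sqrt (B : R) n : 0 <= B -> (0 < n)%N -> B / n%:R <= B / Num.sqrt n%:R.
Proof.
move=> B_ge0 n_gt0; apply: ler_wpM2l => //.
have s_ge1 : 1 <= Num.sqrt (n%:R : R) by rewrite -[X in X <= _]sqrtr1 ler_sqrt ?ler1n.
have s_gt0 := lt_le_trans ltr01 s_ge1.
rewrite lef_pV2 ?posrE ?ltr0n //.
by rewrite -[leRHS]sqr_sqrtr // expr2 ler_peMl // ltW.
Qed.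

Let moment_le (C T : R) n : (0 < n)%N -> `|T - n%:R * v| <= C * Num.sqrt n%:R ->
  `|T / n%:R - v| <= C / Num.sqrt n%:R.
Proof.
move=> n_gt0 T_le; have n_pos : 0 < (n%:R : R) by rewrite ltr0n.
have s_pos : 0 < Num.sqrt (n%:R : R) by rewrite sqrtr_gt0.
have -> : T / n%:R - v = (T - n%:R * v) / n%:R by field; rewrite gt_eqF.
rewrite normrM [`|_^-1|]gtr0_norm ?invr_gt0 // ler_pdivrMr //.
suff -> : C / Num.sqrt n%:R * n%:R = C * Num.sqrt n%:R by [].
have : (n%:R : R) = Num.sqrt n%:R ^+ 2 by rewrite sqr_sqrtr.
by move: s_pos; set r := Num.sqrt _ => r_pos ->; field; rewrite gt_eqF.
Qed.

Lemma gtilde_mean_cvg :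
  (fun n => path_mean Q q (fun omega : path n => gtilde g h omega / n%:R)) @ \oo --> eta.
Proof.
have [B B_le] := gtilde_mean_bounded Q_transition q_distr d_mean h.
apply: (@cvg_inv_sqrt_bound _ _ _ B) => n n_gt0.
have n0 : (n%:R : R) != 0 by rewrite pnatr_eq0 -lt0n.
have -> : path_mean Q q (fun omega : path n => gtilde g h omega / n%:R) - eta =
    n%:R^-1 * E n (@Y n).
  rewrite -[X in _ - X](path_mean_cst Q_transition q_distr n eta).
  rewrite -mulN1r -path_meanZ -path_meanD -path_meanZ.
  by congr path_mean; apply: funext => omega; rewrite /Y; field.
have B_ge0 : 0 <= B by exact: le_trans (B_le 0%N).
apply: le_trans _ (le_inv_sqrt B_ge0 n_gt0).
rewrite normrM ger0_norm ?invr_ge0 // mulrC.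
by apply: ler_wpM2r; rewrite ?invr_ge0.
Qed.

Lemma gtilde_mean_square_error_cvg :
  (fun n => n%:R * path_mean Q q (fun omega : path n => (gtilde g h omega / n%:R - eta) ^+ 2))
    @ \oo --> v.
Proof.
have [C C_le] := gtilde_second_moment_bounded Q_transition q_distr d_mean d_variance h.
apply: (@cvg_inv_sqrt_bound _ _ _ C) => n n_gt0.
have n0 : (n%:R : R) != 0 by rewrite pnatr_eq0 -lt0n.
rewrite -path_meanZ.
rewrite (_ : path_mean _ _ _ = E n (fun omega => Y omega ^+ 2) / n%:R).
  by apply: moment_le => //; exact: C_le.
rewrite mulrC -path_meanZ; congr path_mean; apply: funext => omega.
by rewrite /Y; field.
Qed.

(** Centering at the true mean rather than at [n eta] changes the normalized second moment by
    [e^2 / n], where [e], the mean of [Y], stays bounded. *)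
Lemma gtilde_variance_cvg :
  (fun n => path_variance Q q (fun omega : path n => gtilde g h omega / Num.sqrt n%:R))
    @ \oo --> v.
Proof.
have [B B_le] := gtilde_mean_bounded Q_transition q_distr d_mean h.
have [C C_le] := gtilde_second_moment_bounded Q_transition q_distr d_mean d_variance h.
apply: (@cvg_inv_sqrt_bound _ _ _ (C + B ^+ 2)) => n n_gt0.
have n0 : (n%:R : R) != 0 by rewrite pnatr_eq0 -lt0n.
set r := Num.sqrt (n%:R : R).
have r0 : r != 0 by rewrite gt_eqF // sqrtr_gt0 ltr0n.
have r2 : n%:R = r ^+ 2 by rewrite sqr_sqrtr.
set e := E n (@Y n); set T := E n (fun omega => Y omega ^+ 2).
have meanE : path_mean Q q (fun omega : path n => gtilde g h omega / r) =
    r^-1 * (e + n%:R * eta).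
  rewrite -[X in _ + X](path_mean_cst Q_transition q_distr n) -path_meanD -path_meanZ.
  by congr path_mean; apply: funext => omega; rewrite /Y subrK mulrC.
have -> : path_variance Q q (fun omega : path n => gtilde g h omega / r) =
    T / n%:R - e ^+ 2 / n%:R.
  (* The bracket is the mean of [Y^2 - 2 e Y + e^2 = (Y - e)^2]. *)
  have -> : T / n%:R - e ^+ 2 / n%:R = n%:R^-1 * (T + (- 2 * e) * e + e ^+ 2) by ring.
  rewrite {2}/e -path_meanZ -[X in _ + X](path_mean_cst Q_transition q_distr n).
  rewrite -!path_meanD -path_meanZ /path_variance meanE; congr path_mean.
  by apply: funext => omega; rewrite /Y r2; field.
have -> : T / n%:R - e ^+ 2 / n%:R - v = T / n%:R - v - e ^+ 2 / n%:R by ring.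
apply: le_trans (ler_normB _ _) _; rewrite mulrDl lerD //.
  by apply: moment_le => //; exact: C_le.
apply: le_trans _ (le_inv_sqrt (sqr_ge0 B) n_gt0).
rewrite ger0_norm; last by rewrite divr_ge0 // sqr_ge0.
apply: ler_wpM2r; first by rewrite invr_ge0.
by rewrite -real_normK ?num_real // lerXn2r ?nnegrE ?B_le // (le_trans _ (B_le n)).
Qed.

End Limits.

(** * Asymptotic mean and variance along the exponential family *)

Theorem mainTheorem7 (R : realType) (X : finType)
    (W : X -> X -> R) (g : X -> X -> R)
    (W_transition : transition_matrix W)
    (W_irreducible : irreducible W) (W_ergodic : ergodic W)
    (g_indep : lin_indep W g)
    (P3 : R -> X -> R)
    (P3_PF : forall theta : R,
       PF_eigenvector (fun x x' => tilted W g theta x' x) (P3 theta))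
    (P : R -> X -> R)
    (P_distr : forall theta : R, distribution_on (P theta))
    (P_smooth : smooth_family P)
    (h : X -> R) (theta : R) :
  let phi : R -> R := potential W g in
  let eta : R -> R := phi^`()%classic in
  let Wt : X -> X -> R := exp_family W g P3 theta in
  [/\ derivable phi theta 1,
      derivable eta theta 1,
      (fun n : nat => path_mean Wt (P theta)
         (fun omega : {ffun 'I_n.+1 -> X} => gtilde g h omega / n%:R))
        @ \oo --> eta theta,
      (fun n : nat => n%:R * path_mean Wt (P theta)
         (fun omega : {ffun 'I_n.+1 -> X} =>
            (gtilde g h omega / n%:R - eta theta) ^+ 2))
        @ \oo --> phi^`(2)%classic theta
    & (fun n : nat => path_variance Wt (P theta)
         (fun omega : {ffun 'I_n.+1 -> X} => gtilde g h omega / Num.sqrt n%:R))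
        @ \oo --> phi^`(2)%classic theta].
Proof.
move=> phi eta Wt; clear P_smooth g_indep W_ergodic.
have W_ge0 x x' : 0 <= W x x' by have [] := W_transition x'.
have W_conn := irreducible_connected W_ge0 W_irreducible.
(* A distribution of total mass 1 cannot live on an empty set. *)
have [x0 _] : exists x0 : X, True.
  apply: contrapT => noX; have [_] := P_distr theta.
  rewrite big1 => [/esym/eqP|x _]; first by rewrite oner_eq0.
  by case: noX; exists x.
pose lam t := PF_eigenvalue (tilted W g t).
pose s t := \sum_x P3 t x.
have P3_gt0 t x : 0 < P3 t x by have [] := P3_PF t.
have s_gt0 t : 0 < s t := sum_gt0 x0 (P3_gt0 t).
(* The scale of [P3 t] may vary arbitrarily with [t]; fixing the total mass removes this freedom and
   makes the eigenvector differentiable in [t]. *)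
pose p t x := P3 t x / s t.
have p_gt0 t x : 0 < p t x by rewrite divr_gt0.
have p_sum t : \sum_x p t x = 1 by rewrite /p -mulr_suml divff // gt_eqF // s_gt0.
have p_eigen t x' : \sum_x p t x * tilted W g t x x' = lam t * p t x'.
  have [_ /(_ x')] := P3_PF t; rewrite (PF_eigenvalue_transpose (tilted W g t)).
  rewrite -/(lam t) => P3_eigen.
  rewrite /p mulrA -P3_eigen mulr_suml.
  by apply: eq_bigr => x _; rewrite mulrAC [P3 t x * _]mulrC.
have A_ge0 t x x' : 0 <= tilted W g t x x' := tilted_ge0 g t x x' W_ge0.
have A_conn t := @tilted_connected R X W g t W_conn.
have /choice[w w_spec] : forall t, exists w : X -> R, [/\ forall x, 0 < w x,
    \sum_x w x = 1 & forall x, \sum_x' tilted W g t x x' * w x' = lam t * w x].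
  move=> t.
  exact: (normalized_right_eigenvector (A_ge0 t) (A_conn t) (p_gt0 t) (p_eigen t) x0).
have w_gt0 t x : 0 < w t x by have [] := w_spec t.
have w_sum t : \sum_x w t x = 1 by have [] := w_spec t.
have w_eigen t x : \sum_x' tilted W g t x x' * w t x' = lam t * w t x.
  by have [] := w_spec t.
(* If [lam t] were 0, the eigenvector equation at [x0] would force [W x x0 = 0] for all [x], against
   the column sum 1. *)
have lam_gt0 t : 0 < lam t.
  rewrite lt_def (left_eigenvalue_ge0 (A_ge0 t) (p_gt0 t) (p_eigen t) x0) andbT.
  apply: contraTneq (ltr01 : 0 < (1 : R)) => lam0.
  have [_ <-] := W_transition x0; rewrite big1 ?ltxx // => x _.
  have := p_eigen t x0; rewrite lam0 mul0r => /eqP.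
  rewrite psumr_eq0 => [/allP/(_ x)|y _]; last by rewrite mulr_ge0 // ltW.
  rewrite mem_index_enum => /(_ isT).
  rewrite mulf_eq0 (gt_eqF (p_gt0 t x)) /= /tilted mulf_eq0.
  by rewrite (gt_eqF (expR_gt0 _)) orbF => /eqP.
have [dphi deta] := log_eigenvalue_twice_derivable
  W_ge0 W_conn p_gt0 p_sum p_eigen w_gt0 w_sum w_eigen lam_gt0.
(* The normalizing factor [s theta] cancels between [x] and [x']. *)
have WtE : Wt = (fun x x' =>
    (lam theta)^-1 * p theta x * tilted W g theta x x' * (p theta x')^-1).
  apply: funext => x; apply: funext => x'; rewrite /Wt /exp_family -/(lam theta) /p.
  by field; rewrite !gt_eqF ?lam_gt0 ?s_gt0 ?P3_gt0.
have Wt_transition : transition_matrix Wt.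
  by rewrite WtE; apply: exp_family_transition.
pose f x : R := (fun t => p t x)^`()%classic theta / p theta x.
pose k x : R := (fun t => p t x)^`()^`()%classic theta / p theta x - f x ^+ 2.
have d_mean x' : \sum_x Wt x x' * (g x x' + f x - f x' - eta theta) = 0.
  rewrite WtE; exact: (exp_family_increment_mean
    W_ge0 W_conn p_gt0 p_sum p_eigen w_gt0 w_sum w_eigen lam_gt0).
have d_var x' : \sum_x Wt x x' * (g x x' + f x - f x' - eta theta) ^+ 2 =
    phi^`(2)%classic theta + k x' - \sum_x Wt x x' * k x.
  rewrite WtE; exact: (exp_family_increment_variance
    W_ge0 W_conn p_gt0 p_sum p_eigen w_gt0 w_sum w_eigen lam_gt0).
split.
- exact: dphi.
- exact: deta.
- exact: (gtilde_mean_cvg Wt_transition (P_distr theta) h d_mean).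
- exact: (gtilde_mean_square_error_cvg Wt_transition (P_distr theta) h d_mean d_var).
- exact: (gtilde_variance_cvg Wt_transition (P_distr theta) h d_mean d_var).
Qed.
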